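(* Let $(X_n)$ be a countable (finite or countably infinite) family of Polish spaces, $X=\prod_n X_n$ with the product topology, and for every $n$ let $\nu_n$ be a Borel probability measure on $X_n$. For $f\in B(\nu)$ define $$\phi(f):=\inf\Big\{m+\sum_n\langle g_n,\nu_n\rangle : m\in\mathbb{R},\ \oplus g\in G(\nu)\text{ such that } m+\oplus g\ge f\Big\}.$$ Then $$\phi(f)=\max_{\mu\in\mathcal{P}(\nu)}\langle f,\mu\rangle\quad\text{for all } f\in B(\nu)\cap(U(\nu)+G(\nu)).$$
   Context: $\mathcal{P}(\nu)$ is the set of all Borel probability measures $\mu$ on $X$ with marginals $\mu\circ\pi_n^{-1}=\nu_n$ for all $n$, where $\pi_n:X\to X_n$ is the $n$-th coordinate projection. $B_b$ is the set of bounded Borel measurable functions $X\to\mathbb{R}$; $B$ is the space of all Borel measurable functions $f:X\to\mathbb{R}$, $U\subseteq B$ the subset of upper semicontinuous functions $X\to\mathbb{R}$, and $B_n^+$ the set of all Borel measurable functions $X_n\to\mathbb{R}_+=[0,\infty)$. $\langle f,\mu\rangle:=\int f\,d\mu$. For $g=(g_n)\in\prod_n B_n^+$, $\oplus g:=\sum_n g_n\circ\pi_n:X\to\mathbb{R}_+\cup\{+\infty\}$. Define $$G(\nu):=\Big\{\oplus g:(g_n)\in\prod_n B_n^+\text{ such that }\sum_n\langle g_n,\nu_n\rangle<+\infty\Big\},$$ $$B(\nu):=\{f\in B:|f|\le\oplus g\text{ for some }\oplus g\in G(\nu)\},\qquad U(\nu):=\{f\in U:f^+\in B_b\text{ and }f^-\in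 B(\nu)\}.$$ $U(\nu)+G(\nu)$ is the set of functions $h+\oplus g$ with $h\in U(\nu)$, $\oplus g\in G(\nu)$. Inequalities between functions are pointwise on $X$. *)

(* Defs.v *)
From HB Require Import structures.
From mathcomp Require Import all_boot all_order all_algebra.
From mathcomp Require Import all_classical all_reals all_analysis.

Set Implicit Arguments.
Unset Strict Implicit.
Unset Printing Implicit Defensive.

Import Order.TTheory GRing.Theory Num.Theory.
Import numFieldNormedType.Exports.

Local Open Scope classical_set_scope.
Local Open Scope ring_scope.

(* The Borel sigma-algebra. Spaces are pointed because measurable types are;
   a space carrying a probability measure is nonempty anyway. *)
Notation borel T := (g_sigma_algebraType (@open T)).

Definition complete_metrization (R : realType) (T : topologicalType)
    (d : T -> T -> R) : Prop :=
  [/\ [/\ forall x y, d x y = 0 <-> x = y,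
          forall x y, d x y = d y x &
          forall x y z, d x z <= d x y + d y z],
      forall x (A : set T),
        nbhs x A <-> exists2 e : R, 0 < e & [set y | d x y < e] `<=` A &
      forall u : nat -> T,
        (forall e : R, 0 < e -> exists N : nat, forall m n : nat,
           (N <= m)%N -> (N <= n)%N -> d (u m) (u n) < e) ->
        exists l : T, u @ \oo --> l].

Definition polish (R : realType) (T : topologicalType) : Prop :=
  (exists d : T -> T -> R, complete_metrization d) /\
  (exists2 D : set T, countable D & dense D).

Definition upper_semicontinuous (R : realType) (T : topologicalType)
    (f : T -> R) : Prop :=
  forall (x : T) (a : R), f x < a -> \forall y \near x, f y < a.

Section spaces.
Context {R : realType} {I : countType} {X_ : I -> ptopologicalType}.
Variable nu : forall n, probability (borel (X_ n)) R.

Let X := prod_topology X_.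

Definition couplings : set (probability (borel X) R) :=
  [set mu | forall n (A : set (borel (X_ n))), measurable A ->
     pushforward mu (fun x : borel X => x n : borel (X_ n)) A = nu n A].

Definition borel_fun (f : X -> R) : Prop :=
  measurable_fun [set: borel X] (f : borel X -> R).

Definition borel_bounded (f : X -> R) : Prop :=
  borel_fun f /\ exists M : R, forall x, `|f x| <= M.

Definition borel_nneg n (g : X_ n -> R) : Prop :=
  measurable_fun [set: borel (X_ n)] (g : borel (X_ n) -> R) /\
  forall x, 0 <= g x.

Definition oplus (g : forall n, X_ n -> R) : X -> \bar R :=
  fun x => (\esum_(n in [set: I]) (g n (x n))%:E)%E.

Definition total_cost (g : forall n, X_ n -> R) : \bar R :=
  (\esum_(n in [set: I]) \int[nu n]_x (g n x)%:E)%E.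

Definition G_family : set (forall n, X_ n -> R) :=
  [set g | (forall n, borel_nneg (g n)) /\ (total_cost g < +oo)%E].

Definition G_space : set (X -> \bar R) := [set oplus g | g in G_family].

Definition B_space : set (X -> R) :=
  [set f | borel_fun f /\
           exists2 k, G_space k & forall x, (`|f x|%:E <= k x)%E].

Definition U_space : set (X -> R) :=
  [set f | [/\ borel_fun f, upper_semicontinuous f,
               borel_bounded f^\+ & B_space f^\-]].

Definition UG_space : set (X -> \bar R) :=
  [set (fun x => (h x)%:E + k x)%E | h in U_space & k in G_space].

Definition phi (f : X -> R) : \bar R :=
  ereal_inf [set y | exists (m : R) (g : forall n, X_ n -> R),
    [/\ G_family g,
        forall x, ((f x)%:E <= m%:E + oplus g x)%E &
        y = (m%:E + total_cost g)%E]].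

End spaces.

(* Main.v *)
Require Import Defs.
From HB Require Import structures.
From mathcomp Require Import finmap.
From mathcomp Require Import all_boot all_order all_algebra.
From mathcomp Require Import all_classical all_reals all_analysis.
From mathcomp Require Import measurable_realfun lra.
Import numFieldNormedType.Exports.

Set Implicit Arguments.
Unset Strict Implicit.
Unset Printing Implicit Defensive.

Import Order.TTheory GRing.Theory Num.Theory.

Local Open Scope classical_set_scope.
Local Open Scope ring_scope.

(** Every coupling [mu] satisfies [\int f dmu <= phi f]: integrating
    [f <= m + oplus g] gives [m + total_cost g], because the integral of a sum
    of nonnegative functions of single coordinates depends on the marginals
    only ([integral_le_phi]).  The content of the theorem is a coupling for
    which equality holds.

    It is found by duality.  On the space of the functions [f] with
    [|f| <= m + oplus g] for some [m] and some [g] of finite total cost,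
    measurable or not, [phi] is finite and sublinear ([sublinear_phi]).  It is
    finite because an inequality [0 <= m + oplus g] that holds at every point
    also holds on average: it suffices to evaluate it at a point each
    coordinate of which makes [g n] at most its mean ([total_cost_lb]).  By
    Hahn-Banach there is an additive [l <= phi] with [l f = phi f]
    ([hahn_banach_on]).

    The set function [A |-> l 1_A] is a finitely additive probability on all
    subsets of the product, and [l <= phi] bounds it on a countable union of
    cylinders with bases [A n] by the sum of the [nu n (A n)]
    ([functional_set_cylinders]).  This single bound gives two things.  As each
    [nu n] is tight (Ulam), a product of compact sets carries almost all the
    mass; and a cylinder has at most the mass that its marginal prescribes.
    Tightness replaces countable additivity: the outer measure generated by
    inner approximation with closed sets is a Borel probability [mu] with
    [mu G <= l 1_G] for every open [G] ([exists_probability_le_open]).  Hence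
    the marginals of [mu] are at most [nu n] on open sets, which forces
    equality for probabilities on a metrizable space
    ([measure_eq_of_le_open]), and [mu] is a coupling.

    The inequality on open sets passes to nonnegative lower semicontinuous
    [v]: such a [v] is the limit from below of multiples of sums of indicators
    of its open superlevel sets, so [\int v dmu <= l v] ([integral_lsc_le]).  Write
    [f = h + oplus g] with [h] upper semicontinuous and [h <= M].  With
    [v = M - h] this says [l h <= \int h dmu], while
    [l (oplus g) <= total_cost g = \int oplus g dmu].  Adding up,
    [phi f = l f <= \int f dmu]. *)

(** * Hahn-Banach for a sublinear functional on a subspace *)

Section hahn_banach.
Context {R : realType} {V : lmodType R} (W : set V).
Hypothesis WD : forall x y, W x -> W y -> W (x + y).
Hypothesis WZ : forall c x, W x -> W (c *: x).

Definition sublinear_on (q : V -> R) :=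
  (forall x y, W x -> W y -> q (x + y) <= q x + q y) /\
  (forall c x, 0 < c -> W x -> q (c *: x) <= c * q x).

Lemma sublinear_onZ q c x : sublinear_on q -> 0 < c -> W x ->
  q (c *: x) = c * q x.
Proof.
move=> [_ qZ] c0 Wx; apply/eqP; rewrite eq_le qZ//=.
have := qZ c^-1 (c *: x); rewrite invr_gt0 => /(_ c0 (WZ c Wx)).
by rewrite scalerA mulVf ?gt_eqF// scale1r mulrC ler_pdivlMr// mulrC.
Qed.

Lemma sublinear_on_opp_le q x : sublinear_on q -> W x -> - q (- x) <= q x.
Proof.
move=> sq Wx; have WNx : W (- x) by rewrite -scaleN1r; exact: WZ.
have W0 : W 0 by rewrite -(scale0r x); exact: WZ.
have := sublinear_onZ sq (@ltr0n R 2) W0; rewrite scaler0 => q0.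
have := sq.1 _ _ Wx WNx; rewrite subrr; lra.
Qed.

(** Tilting [q] along [a] is the one-dimensional extension step of the
    Hahn-Banach theorem in the form of an operation on sublinear functionals:
    the result lies below [q], and its value at [x] is at most
    [q (x + a) - q a]. *)
Definition tilt (q : V -> R) (a x : V) : R :=
  inf [set q (x + t *: a) - t * q a | t in [set t | 0 < t]].

Lemma tilt_le q a x t : sublinear_on q -> W a -> W x -> 0 < t ->
  tilt q a x <= q (x + t *: a) - t * q a.
Proof.
move=> sq Wa Wx t0; apply: ge_inf; last by exists t.
exists (- q (- x)) => _ [s s0 <-].
have WNx : W (- x) by rewrite -scaleN1r; exact: WZ.
have := sq.1 _ _ (WD Wx (WZ s Wa)) WNx.
have -> : x + s *: a - x = s *: a by rewrite addrAC subrr add0r.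
rewrite (sublinear_onZ sq s0 Wa); lra.
Qed.

Lemma le_tilt q a x b :
  (forall t, 0 < t -> b <= q (x + t *: a) - t * q a) -> b <= tilt q a x.
Proof.
move=> bq; apply: lb_le_inf; first by exists (q (x + 1 *: a) - 1 * q a); exists 1 => //=.
by move=> _ [t t0 <-]; exact: bq.
Qed.

Lemma sublinear_on_tilt q a : sublinear_on q -> W a -> sublinear_on (tilt q a).
Proof.
move=> sq Wa; split=> [x y Wx Wy|c x c0 Wx].
  rewrite -lerBlDr; apply: le_tilt => t t0.
  rewrite lerBlDr [leRHS]addrC -lerBlDr; apply: le_tilt => s s0.
  rewrite lerBlDr; apply: (le_trans (tilt_le sq Wa (WD Wx Wy) (addr_gt0 t0 s0))).
  have := sq.1 _ _ (WD Wx (WZ t Wa)) (WD Wy (WZ s Wa)).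
  by rewrite addrACA -scalerDl mulrDl; lra.
rewrite mulrC -ler_pdivrMr//; apply: le_tilt => t t0.
rewrite ler_pdivrMr// mulrC.
apply: (le_trans (tilt_le sq Wa (WZ c Wx) (mulr_gt0 c0 t0))).
have := sq.2 _ _ c0 (WD Wx (WZ t Wa)).
by rewrite scalerDr scalerA mulrBr mulrA; lra.
Qed.

Lemma tilt_le_self q a x : sublinear_on q -> W a -> W x -> tilt q a x <= q x.
Proof.
move=> sq Wa Wx; apply: (le_trans (tilt_le sq Wa Wx (@ltr01 R))).
by have := sq.1 _ _ Wx (WZ 1 Wa); rewrite scale1r mul1r; lra.
Qed.

(** Zorn: a chain of sublinear functionals has its pointwise infimum as a lower
    bound, which is finite since [- p (- x)] bounds the whole chain below. *)
Lemma exists_minimal_sublinear p : sublinear_on p ->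
  exists q, [/\ sublinear_on q, forall x, W x -> q x <= p x &
    forall q', sublinear_on q' -> (forall x, W x -> q' x <= q x) ->
      forall x, W x -> q x <= q' x].
Proof.
move=> sp; pose T := {q | sublinear_on q /\ forall x, W x -> q x <= p x}.
pose t0 : T := exist _ p (conj sp (fun x _ => lexx _)).
pose Rel (s t : T) := `[< forall x, W x -> sval t x <= sval s x >].
have [|||t tmax] := ZL_preorder t0 (R := Rel).
- by move=> t; apply/asboolP => x _; exact: lexx.
- move=> r s t /asboolP rs /asboolP st; apply/asboolP => x Wx.
  exact: le_trans (st x Wx) (rs x Wx).
- move=> A Atot.
  have [[a0 Aa0]|A0] := pselect (A !=set0); last first.
    by exists t0 => s As; exfalso; apply: A0; exists s.
  pose E x := [set sval a x | a in A].
  have lbE x : W x -> has_lbound (E x).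
    move=> Wx; exists (- p (- x)) => _ [a Aa <-].
    have [sa ap] := svalP a; apply: (le_trans _ (sublinear_on_opp_le sa Wx)).
    by rewrite lerN2; apply: ap; rewrite -scaleN1r; exact: WZ.
  have infle x a : W x -> A a -> inf (E x) <= sval a x.
    by move=> Wx Aa; apply: ge_inf; [exact: lbE|exists a].
  have leinf x b : (forall a, A a -> b <= sval a x) -> b <= inf (E x).
    move=> bE; apply: lb_le_inf; first by exists (sval a0 x), a0.
    by move=> _ [a Aa <-]; exact: bE.
  have sinf : sublinear_on (fun x => inf (E x)).
    split=> [x y Wx Wy|c x c0 Wx].
      rewrite -lerBlDr; apply: (@leinf) => a Aa.
      rewrite lerBlDr [leRHS]addrC -lerBlDr; apply: (@leinf) => b Ab; rewrite lerBlDr.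
      (* at [x + y] use the smaller of the two members of the chain: it is
         subadditive and lies below both *)
      have [/asboolP ab|/asboolP ba] := Atot _ _ Aa Ab.
        apply: (le_trans (infle _ _ (WD Wx Wy) Ab)).
        have := (svalP b).1.1 _ _ Wx Wy; have := ab _ Wx; lra.
      apply: (le_trans (infle _ _ (WD Wx Wy) Aa)).
      have := (svalP a).1.1 _ _ Wx Wy; have := ba _ Wy; lra.
    rewrite mulrC -ler_pdivrMr//; apply: (@leinf) => a Aa.
    rewrite ler_pdivrMr// mulrC; apply: (le_trans (infle _ _ (WZ c Wx) Aa)).
    exact: (svalP a).1.2.
  have infp x : W x -> inf (E x) <= p x.
    by move=> Wx; apply: (le_trans (infle _ _ Wx Aa0)); apply: (svalP a0).2.
  pose t : T := exist _ (fun x => inf (E x)) (conj sinf infp).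
  exists t => s As; apply/asboolP => x Wx /=.
  exact: infle.
exists (sval t); have [st tp] := svalP t; split => // q' sq' q't x Wx.
have q'p y : W y -> q' y <= p y by move=> Wy; apply: (le_trans (q't _ Wy)); exact: tp.
pose t' : T := exist _ q' (conj sq' q'p).
have /tmax/asboolP : Rel t t' by apply/asboolP.
exact.
Qed.

(** A minimal sublinear functional equals each of its tilts, which is exactly
    additivity.  Minimizing below the tilt of [p] along [f], rather than below
    [p], makes the value at [- f] at most [- p f]. *)
Lemma hahn_banach_on p f : sublinear_on p -> W f ->
  exists l : V -> R, [/\ forall x, W x -> l x <= p x,
    forall x y, W x -> W y -> l (x + y) = l x + l y & l f = p f].
Proof.
move=> sp Wf; have [l [sl lp lmin]] := exists_minimal_sublinear (sublinear_on_tilt sp Wf).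
have llep x : W x -> l x <= p x.
  by move=> Wx; apply: (le_trans (lp _ Wx)); exact: tilt_le_self.
exists l; split => //.
  move=> x y Wx Wy; apply/eqP; rewrite eq_le sl.1//= -lerBrDr.
  (* minimality bounds [l] by its tilt along [y], taken with parameter 1 *)
  apply: (le_trans (lmin _ (sublinear_on_tilt sl Wy) _ _ Wx)) => [z Wz|].
    exact: tilt_le_self.
  by apply: (le_trans (tilt_le sl Wy Wx (@ltr01 R))); rewrite scale1r mul1r.
apply/eqP; rewrite eq_le llep//=.
have WNf : W (- f) by rewrite -scaleN1r; exact: WZ.
have W0 : W 0 by rewrite -(scale0r f); exact: WZ.
have := sublinear_onZ sp (@ltr0n R 2) W0; rewrite scaler0 => p0.
have := le_trans (lp _ WNf) (tilt_le sp Wf WNf (@ltr01 R)).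
have := sublinear_on_opp_le sl Wf.
rewrite scale1r mul1r addNr; lra.
Qed.

End hahn_banach.

(** * From tight finitely additive set functions to Borel probabilities *)

Section additive_set_function.
Context {R : realType} {T : Type} (lam : set T -> R).
Hypothesis lam_ge0 : forall A, 0 <= lam A.
Hypothesis lamU : forall A B, A `&` B = set0 -> lam (A `|` B) = lam A + lam B.

Lemma additive_set0 : lam set0 = 0.
Proof. by have := lamU (setI0 (@set0 T)); rewrite setU0; lra. Qed.

Lemma additive_le A B : A `<=` B -> lam A <= lam B.
Proof.
move=> AB; have -> : B = A `|` (B `\` A) by rewrite setDUK.
by rewrite lamU ?lerDl// setDIK.
Qed.

Lemma additiveU_le A B : lam (A `|` B) <= lam A + lam B.
Proof.
rewrite -(setDUK (@subsetUl _ A B)) lamU ?setDIK// lerD2l.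
by apply: additive_le => x [[]].
Qed.

Lemma additive_bigcup_le (A : (set T)^nat) n :
  lam (\bigcup_(i < n) A i) <= \sum_(i < n) lam (A i).
Proof.
rewrite bigcup_mkord; elim: n => [|n ih]; first by rewrite !big_ord0 additive_set0.
by rewrite !big_ord_recr/=; apply: (le_trans (additiveU_le _ _)); rewrite lerD2r.
Qed.

End additive_set_function.

(** A point of [C] lies in some [G i] and, by regularity, has a neighbourhood
    whose closure stays in [G i]; finitely many of these closures cover [C]
    and are grouped according to [i]. *)
Lemma compact_countable_cover_closed (T : ptopologicalType) (C : set T)
    (G : (set T)^nat) : regular_space T -> compact C ->
  (forall i, open (G i)) -> C `<=` \bigcup_i G i ->
  exists n (D : (set T)^nat), [/\ forall i, closed (D i),
    forall i, D i `<=` G i & C `<=` \bigcup_(i < n) D i].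
Proof.
move=> regT Cc Go CG.
have /choice[iN iNP] x : exists iN : nat * set T,
    C x -> nbhs x iN.2 /\ closure iN.2 `<=` G iN.1.
  have [Cx|nCx] := pselect (C x); last by exists (0%N, set0).
  have [i _ Gx] := CG _ Cx.
  have [N Nx NG] := regT x (G i) (open_nbhs_nbhs (conj (Go i) Gx)).
  by exists (i, N).
have Cc' : cover_compact C by rewrite -compact_cover.
have [x _|x Cx|D' D'C CD'] := Cc' T C (fun x => interior (iN x).2).
- exact: open_interior.
- by exists x => //; exact: (iNP x Cx).1.
pose D j := \bigcup_(x in ([set` D'] `&` [set x | (iN x).1 = j])) closure (iN x).2.
exists (\max_(x <- finmap.enum_fset D') (iN x).1).+1, D; split=> [i|i y [x [xD' <-]]|y Cy].
- apply: closed_bigcup => [|x _]; last exact: closed_closure.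
  by apply: (@sub_finite_set _ _ [set` D']) => //; exact: subIsetl.
- by apply: (iNP x _).2; exact/set_mem/D'C.
- have [x /= xD' /interior_subset ixy] := CD' _ Cy.
  exists (iN x).1 => /=; last by exists x => //; exact: subset_closure.
  by rewrite ltnS; apply: (@leq_bigmax_seq _ _ _ (fun x => (iN x).1)).
Qed.

Section regularization.
Context {R : realType} {T : ptopologicalType} (lam : set T -> R).
Hypothesis regT : regular_space T.
Hypothesis lam_ge0 : forall A, 0 <= lam A.
Hypothesis lamU : forall A B, A `&` B = set0 -> lam (A `|` B) = lam A + lam B.
Hypothesis lamT : lam setT = 1.
Hypothesis lam_tight : forall e, 0 < e ->
  exists K, [/\ compact K, closed K & lam (~` K) <= e].

(** Approximating from inside by closed sets restores the countable
    subadditivity that [lam] lacks, at the price of a smaller value on open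
    sets. *)
Definition inner_content (G : set T) : R :=
  sup [set lam F | F in [set F | closed F /\ F `<=` G]].

Definition outer_content (A : set T) : R :=
  inf [set inner_content G | G in [set G | open G /\ A `<=` G]].

Let lam_le := additive_le lam_ge0 lamU.

Let le_inner F G : closed F -> F `<=` G -> lam F <= inner_content G.
Proof.
move=> cF FG; apply: ub_le_sup; last by exists F.
by exists (lam G) => _ [F' [_ F'G] <-]; exact: lam_le.
Qed.

Let inner_le G b : (forall F, closed F -> F `<=` G -> lam F <= b) ->
  inner_content G <= b.
Proof.
move=> Fb; apply: ge_sup; last by move=> _ [F [cF FG] <-]; exact: Fb.
by exists (lam set0), set0 => //; split => //; exact: closed0.
Qed.

Lemma inner_content_le G : inner_content G <= lam G.
Proof. by apply: inner_le => F _; exact: lam_le. Qed.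

Lemma inner_content_ge0 G : 0 <= inner_content G.
Proof. by rewrite -(additive_set0 lamU); exact: le_inner closed0 _. Qed.

Lemma inner_content_adherent G e : 0 < e ->
  exists F, [/\ closed F, F `<=` G & inner_content G - e < lam F].
Proof.
move=> e0; apply: contrapT => nF.
have : inner_content G <= inner_content G - e.
  apply: inner_le => F cF FG; rewrite leNgt; apply/negP => Fe.
  by apply: nF; exists F.
by rewrite lerBrDr gerDl leNgt e0.
Qed.

(** Up to [e], a closed subset of the union may be taken inside a compact set
    of almost full mass; it is then covered by finitely many closed pieces,
    each inside one [G i], and finite additivity applies. *)
Lemma inner_content_subadditive (G : (set T)^nat) : (forall i, open (G i)) ->
  ((inner_content (\bigcup_i G i))%:E <= \sum_(i <oo) (inner_content (G i))%:E)%E.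
Proof.
move=> Go; apply/lee_addgt0Pr => e e0.
have [K [Kc cK Ke]] := lam_tight e0.
suff FG F : closed F -> F `<=` \bigcup_i G i ->
    ((lam F)%:E <= \sum_(i <oo) (inner_content (G i))%:E + e%:E)%E.
  have [F [cF FG' _]] := inner_content_adherent (\bigcup_i G i) e0.
  have := FG _ cF FG'.
  case E : (\sum_(i <oo) _)%E => [s| |] // _.
    rewrite -EFinD lee_fin; apply: inner_le => F' cF' F'G.
    by have := FG F' cF' F'G; rewrite E -EFinD lee_fin.
  by rewrite leey.
move=> cF FG.
have [n [D [cD DG FKD]]] := compact_countable_cover_closed regT
  (compact_closedI Kc cF) Go (subset_trans (@subIsetr _ _ _) FG).
have FU : F `<=` \bigcup_(i < n) D i `|` ~` K.
  by move=> x Fx; have [Kx|nKx] := pselect (K x); [left; exact: FKD|right].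
apply: (@le_trans _ _ ((\sum_(i < n) inner_content (G i))%:E + e%:E)%E).
  rewrite -EFinD lee_fin (le_trans (lam_le FU))//.
  rewrite (le_trans (additiveU_le lam_ge0 lamU _ _))// lerD//.
  rewrite (le_trans (additive_bigcup_le lam_ge0 lamU _ _))//.
  by apply: ler_sum => i _; exact: le_inner.
rewrite leeD2r// -sumEFin -(big_mkord xpredT (fun i => (inner_content (G i))%:E)).
by apply: nneseries_lim_ge => i _ _; rewrite lee_fin inner_content_ge0.
Qed.

Let outer_le A G : open G -> A `<=` G -> outer_content A <= inner_content G.
Proof.
move=> oG AG; apply: ge_inf; last by exists G.
by exists 0 => _ [G' _ <-]; exact: inner_content_ge0.
Qed.

Let le_outer A b : (forall G, open G -> A `<=` G -> b <= inner_content G) ->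
  b <= outer_content A.
Proof.
move=> bG; apply: lb_le_inf; last by move=> _ [G [oG AG] <-]; exact: bG.
by exists (inner_content setT), setT => //; split => //; exact: openT.
Qed.

Lemma outer_content_open G : open G -> outer_content G = inner_content G.
Proof.
move=> oG; apply/eqP; rewrite eq_le outer_le//=; apply: le_outer => G' _ GG'.
by apply: inner_le => F cF FG; apply: le_inner => //; exact: subset_trans GG'.
Qed.

Lemma outer_content_ge0 A : 0 <= outer_content A.
Proof. by apply: le_outer => G _ _; exact: inner_content_ge0. Qed.

Lemma outer_content_mono A B : A `<=` B -> outer_content A <= outer_content B.
Proof.
by move=> AB; apply: le_outer => G oG BG; apply: outer_le => //; exact: subset_trans BG.
Qed.

Lemma outer_content_adherent A e : 0 < e ->
  exists G, [/\ open G, A `<=` G & inner_content G < outer_content A + e].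
Proof.
move=> e0; apply: contrapT => nG.
have : outer_content A + e <= outer_content A.
  apply: le_outer => G oG AG; rewrite leNgt; apply/negP => Ge.
  by apply: nG; exists G.
by rewrite gerDl leNgt e0.
Qed.

Lemma outer_content0 : outer_content set0 = 0.
Proof.
rewrite (outer_content_open open0); apply/eqP.
by rewrite eq_le inner_content_ge0 (le_trans (inner_content_le _)) ?additive_set0.
Qed.

Lemma outer_content_subadditive :
  sigma_subadditive (fun A => (outer_content A)%:E).
Proof.
move=> F; apply/lee_addgt0Pr => e e0.
have /choice[G GP] : forall i, exists Gi, [/\ open Gi, F i `<=` Gi &
    inner_content Gi < outer_content (F i) + e / (2 ^ i.+1)%:R].
  by move=> i; apply: outer_content_adherent; rewrite divr_gt0// ltr0n expn_gt0.
have Go i : open (G i) by have [] := GP i.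
have FG : \bigcup_i F i `<=` \bigcup_i G i.
  by apply: subset_bigcup => i _; have [] := GP i.
apply: (@le_trans _ _ (inner_content (\bigcup_i G i))%:E).
  by rewrite lee_fin; apply: outer_le => //; exact: bigcup_open.
apply: (le_trans (inner_content_subadditive Go)).
apply: (le_trans _ (epsilon_trick xpredT _ (ltW e0))) => [|i]; last first.
  by rewrite lee_fin outer_content_ge0.
apply: lee_nneseries => i _; first by rewrite lee_fin inner_content_ge0.
by rewrite -EFinD lee_fin ltW//; have [] := GP i.
Qed.

Definition outer_content_measure : {outer_measure set T -> \bar R} :=
  HB.pack (fun A => (outer_content A)%:E) (isOuterMeasure.Build R T
    (fun A => (outer_content A)%:E) (congr1 EFin outer_content0)
    (fun A => outer_content_ge0 A)
    (fun A B AB => outer_content_mono AB) outer_content_subadditive).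

(** An open [V] that covers [A] contains a closed [F] inside [V `&` G] and then
    a closed [F'] disjoint from [F], both almost optimal.  The open set
    [V `\` F] still covers the part of [A] outside [G], so additivity of [lam]
    on [F] and [F'] is the Caratheodory inequality up to [e]. *)
Lemma outer_content_open_caratheodory G : open G ->
  caratheodory_measurable outer_content_measure G.
Proof.
move=> oG; apply: le_caratheodory_measurable => A.
rewrite -EFinD lee_fin; apply: le_outer => V oV AV.
apply/ler_addgt0Pr => e e0.
have e20 : 0 < e / 2 by rewrite divr_gt0.
have oVG : open (V `&` G) by exact: openI.
have [F [cF FVG VGF]] := inner_content_adherent (V `&` G) e20.
have oVF : open (V `\` F) by rewrite setDE; apply: openI => //; exact: closed_openC.
have [F' [cF' F'VF VFF']] := inner_content_adherent (V `\` F) e20.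
have FF' : F `&` F' = set0.
  by rewrite -subset0 => x [Fx /F'VF[_ /(_ Fx)]].
have lamFF' : lam F + lam F' <= inner_content V.
  rewrite -lamU//; apply: le_inner; first exact: closedU.
  by move=> x [/FVG[]|/F'VF[]].
have AG : outer_content (A `&` G) <= inner_content (V `&` G).
  by apply: outer_le => //; exact: setSI.
have AG' : outer_content (A `&` ~` G) <= inner_content (V `\` F).
  by apply: outer_le => // x [/AV Vx nGx]; split => // /FVG[].
lra.
Qed.

Lemma exists_probability_le_open :
  exists mu : probability (borel T) R, forall G, open G -> (mu G <= (lam G)%:E)%E.
Proof.
have borel_cara (A : set (borel T)) :
    measurable A -> outer_content_measure.-cara.-measurable A.
  apply: smallest_sub; last by move=> G; exact: outer_content_open_caratheodory.
  split; first exact: measurable0.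
  - by move=> B mB; rewrite setTD; exact: measurableC.
  - by move=> F mF; exact: bigcupT_measurable.
pose m (A : set (borel T)) := (outer_content A)%:E.
have m0 : m set0 = 0%E by rewrite /m outer_content0.
have m_ge0 A : (0 <= m A)%E by rewrite lee_fin outer_content_ge0.
have m_sigma : semi_sigma_additive m.
  move=> F mF tF mUF.
  apply: (@caratheodory_measure_sigma_additive R T outer_content_measure) => //.
    by move=> i; exact: borel_cara.
  exact: borel_cara.
have mT : m setT = 1%E.
  rewrite /m outer_content_open; last exact: openT.
  congr EFin; apply/eqP; rewrite eq_le -{1}lamT inner_content_le/=.
  by rewrite -lamT; apply: le_inner => //; exact: closedT.
pose mu0 : {measure set (borel T) -> \bar R} := HB.pack m
  (isMeasure.Build _ _ _ m m0 m_ge0 m_sigma).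
have mu0T : mu0 setT = 1%E by [].
pose mu : probability (borel T) R := HB.pack (Measure.sort mu0)
  (Measure_isProbability.Build _ _ _ mu0 mu0T).
exists mu => G oG; rewrite lee_fin outer_content_open//.
exact: inner_content_le.
Qed.

End regularization.

(** * Borel probabilities on complete separable metric spaces *)

Section metric.
Context {R : realType} {T : ptopologicalType} (d : T -> T -> R).
Hypothesis dP : complete_metrization d.

Let dxx x : d x x = 0. Proof. by have [[d0 _ _] _ _] := dP; apply/d0. Qed.
Let dC x y : d x y = d y x. Proof. by have [[]] := dP. Qed.
Let dtri x y z : d x z <= d x y + d y z. Proof. by have [[]] := dP. Qed.

Lemma nbhs_metrization x e : 0 < e -> nbhs x [set y | d x y < e].
Proof. by move=> e0; have [_ n _] := dP; apply/n; exists e. Qed.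

Lemma metrization_nbhs x A : nbhs x A ->
  exists2 e : R, 0 < e & [set y | d x y < e] `<=` A.
Proof. by have [_ n _] := dP; move/n. Qed.

Lemma closed_metric_ball x r : closed [set y | d x y <= r].
Proof.
move=> y cly /=; apply/ler_addgt0Pr => e e0.
have [z [/= xz yz]] := cly _ (nbhs_metrization y e0).
by have := dtri x z y; rewrite (dC z y); lra.
Qed.

Lemma closed_metric_far x r : closed [set y | r <= d x y].
Proof.
move=> y cly /=; apply/ler_addgt0Pr => e e0.
have [z [/= xz yz]] := cly _ (nbhs_metrization y e0).
by have := dtri x y z; lra.
Qed.

Lemma metrizable_regular : regular_space T.
Proof.
move=> x A /metrization_nbhs[e e0 eA].
exists [set y | d x y < e / 2]; first by apply: nbhs_metrization; lra.
move=> y cly; apply: eA => /=; suff : d x y <= e / 2 by lra.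
apply: closed_metric_ball; move: y cly; apply: closureS => z /=.
exact: ltW.
Qed.

Lemma open_bigcup_closed (G : set T) : open G -> exists F : (set T)^nat,
  [/\ forall n, closed (F n), nondecreasing_seq F & G = \bigcup_n F n].
Proof.
move=> oG; exists (fun n => \bigcap_(y in ~` G) [set x | n.+1%:R^-1 <= d y x]).
split=> [n|m n mn|].
- by apply: closed_bigI => y _; exact: closed_metric_far.
- apply/subsetPset => x Fx y Gy /=; apply: le_trans (Fx y Gy).
  by rewrite lef_pV2 ?posrE// ler_nat.
(* a radius of a ball inside [G] bounds the distances to [~` G] below *)
- apply/seteqP; split=> [x Gx|x [n _ Fx]]; last first.
    apply: contrapT => /(Fx x)/=; rewrite dxx.
    by apply/negP; rewrite -ltNge invr_gt0.
  have [e e0 eG] := metrization_nbhs (open_nbhs_nbhs (conj oG Gx)).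
  have [N _ /(_ N (leqnn N)) Ne] := near_infty_natSinv_lt (PosNum e0).
  exists N => // y nGy /=; rewrite leNgt; apply/negP => dyx; apply: nGy.
  by apply: eG; rewrite /= dC; exact: lt_trans Ne.
Qed.

(** Taking complements, the inequality is reversed on closed sets.  An open set
    is an increasing union of closed sets, so continuity from below reverses
    it on open sets too, and these form a generating pi-system. *)
Lemma measure_eq_of_le_open (mu : {measure set (borel T) -> \bar R})
    (nu : probability (borel T) R) :
  mu setT = 1%E -> (forall G, open G -> (mu G <= nu G)%E) ->
  forall A, measurable A -> mu A = nu A.
Proof.
move=> muT munu.
have mu_fin (A : set (borel T)) : measurable A -> mu A \is a fin_num.
  move=> mA; rewrite ge0_fin_numE//; apply: (@le_lt_trans _ _ (mu setT)).
    by apply: le_measure; [exact: mem_set|exact: mem_set|].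
  by rewrite muT ltry.
have muC (A : set (borel T)) : measurable A -> mu (~` A) = (1 - mu A)%E.
  move=> mA; rewrite -muT -(setvU A) measureU ?addeK ?setICl//.
    exact: mu_fin.
  exact: measurableC.
have mo (G : set (borel T)) : open (G : set T) -> measurable G.
  by move=> oG; exact: sub_sigma_algebra.
have mc (F : set (borel T)) : closed (F : set T) -> measurable F.
  by move=> cF; rewrite -(setCK F); apply: measurableC; apply: mo; exact: closed_openC.
have numu (F : set (borel T)) : closed (F : set T) -> (nu F <= mu F)%E.
  move=> cF; have := munu _ (closed_openC cF).
  rewrite muC ?probability_setC; [|exact: mc..].
  have := mu_fin F (mc _ cF); have := fin_num_measure nu F (mc _ cF).
  move=> /fineK <- /fineK <-; rewrite -!EFinB !lee_fin; lra.
have eqG (G : set (borel T)) : open (G : set T) -> mu G = nu G.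
  move=> oG; apply/eqP; rewrite eq_le munu//=.
  have [F [cF ndF GF]] := open_bigcup_closed oG.
  have mF n : measurable (F n : set (borel T)) by apply: mc.
  have : nu (F n) @[n --> \oo] --> nu (\bigcup_n F n).
    by apply: nondecreasing_cvg_mu => //; exact: bigcup_measurable.
  rewrite -GF => /cvg_lim <-//; apply: lime_le.
    apply: ereal_nondecreasing_is_cvgn => m n mn.
    have /subsetPset FF : (F m <= F n)%O by exact: ndF.
    by apply: le_measure => //; exact: (mem_set (mF _)).
  apply: nearW => n; apply: (le_trans (numu _ (cF n))).
  apply: le_measure; [exact: (mem_set (mF _))|exact: (mem_set (mo _ oG))|].
  by rewrite GF; exact: bigcup_sup.
move=> A mA; apply: (@measure_unique _ R (borel T) (@open T) (fun=> setT)) => //.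
- by move=> B C; exact: openI.
- by move=> _; exact: openT.
- by rewrite bigcup_const//; exists 0%N.
- by move=> _ /=; rewrite muT ltry.
Qed.

(** An ultrafilter on this set contains, for each [k], one of the finitely many
    balls of radius [1 / (k + 1)]; points picked from the finite intersections
    of these balls form a Cauchy sequence, and its limit is the limit of the
    ultrafilter. *)
Lemma compact_totally_bounded (a : nat -> T) (N : nat -> nat) :
  compact (\bigcap_k \bigcup_(i < N k) [set y | d (a i) y <= k.+1%:R^-1]).
Proof.
pose B k i := [set y | d (a i) y <= k.+1%:R^-1 :> R].
rewrite compact_ultra => F FU FK.
have ultra_bigcup n (A : (set T)^nat) : F (\bigcup_(i < n) A i) -> exists i, F (A i).
  rewrite bigcup_mkord; elim: n => [|n ih].
    by rewrite big_ord0 => /filter_ex[].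
  rewrite big_ord_recr/= => FA; have [FAn|FnA] := in_ultra_setVsetC (A n) FU.
    by exists n.
  by apply: ih; apply: filterS (filterI FA FnA) => x [[]].
have /choice[c Fc] : forall k, exists i, F (B k i).
  move=> k; by apply: (ultra_bigcup (N k)); apply: filterS FK => x; apply.
have Fcap k : F (\bigcap_(j < k.+1) B j (c j)).
  elim: k => [|k ih].
    by apply: filterS (Fc 0%N) => x Bx j /=; case: j.
  apply: filterS (filterI ih (Fc k.+1)) => x [ihx Bx] j /=.
  by rewrite ltnS leq_eqVlt => /predU1P[->//|jk]; exact: ihx.
have /choice[u uP] : forall k, exists x, (\bigcap_(j < k.+1) B j (c j)) x.
  by move=> k; exact: filter_ex (Fcap k).
have du m n : (m <= n)%N -> d (a (c m)) (u n) <= m.+1%:R^-1.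
  by move=> mn; exact: (uP n m).
have [_ _ complete] := dP.
have [e e0|l ul] := complete u.
  have [M _ /(_ M (leqnn M)) Me] := near_infty_natSinv_lt
    (PosNum (divr_gt0 e0 (ltr0n R 2))).
  exists M => m n Mm Mn; have := dtri (u m) (a (c M)) (u n).
  have := du _ _ Mm; have := du _ _ Mn; rewrite (dC (u m) (a _)); move: Me => /=.
  move: (M.+1%:R^-1) => r; lra.
have Fl : F --> l.
  move=> A /metrization_nbhs[e e0 eA].
  have e40 : 0 < e / 4 by lra.
  have [M _ /(_ M (leqnn M)) Me] := near_infty_natSinv_lt (PosNum e40).
  have [M' _ ulM] := ul _ (nbhs_metrization l e40).
  have /= lu := ulM (maxn M M') (leq_maxr _ _).
  have auM := du _ _ (leq_maxl M M').
  apply: filterS (Fc M) => y; rewrite /B/= => ay; apply: eA => /=.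
  have := dtri l (u (maxn M M')) y; have := dtri (u (maxn M M')) (a (c M)) y.
  rewrite (dC (u _) (a _)); move: Me auM ay => /=; move: (M.+1%:R^-1) => r; lra.
exists l; split=> //; refine (@closed_cvg _ _ F _ id _ _ FK l Fl).
apply: closed_bigI => k _; apply: closed_bigcup => [|i _].
  exact: finite_II.
exact: closed_metric_ball.
Qed.

(** Ulam: for each radius finitely many balls around the points of a dense
    sequence carry all the mass but [e / 2 ^ (k + 1)]. *)
Lemma complete_separable_tight (D : set T) (nu : probability (borel T) R) e :
  countable D -> dense D -> 0 < e ->
  exists K, [/\ compact K, closed K & (nu (~` K) <= e%:E)%E].
Proof.
move=> cD dD e0.
have [y0 [_ Dy0]] : setT `&` D !=set0 by apply: dD; [exists point|exact: openT].
have [|[a]] := pfcard_geP cD; first by move=> D0; rewrite D0 in Dy0.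
pose E k n := \bigcup_(i < n) [set y | d (a i) y <= k.+1%:R^-1].
have cE k n : closed (E k n).
  by apply: closed_bigcup => [|i _]; [exact: finite_II|exact: closed_metric_ball].
have mE k n : measurable (~` E k n : set (borel T)).
  by apply: sub_sigma_algebra; exact: closed_openC.
have capE k : \bigcap_n ~` E k n = set0.
  rewrite -subset0 => x nEx.
  have k0 : 0 < k.+1%:R^-1 :> R by rewrite invr_gt0.
  have [y [/= xy Dy]] : (interior [set y | d x y < k.+1%:R^-1]) `&` D !=set0.
    by apply: dD; [exists x; exact: nbhs_metrization|exact: open_interior].
  have [i _ aiy] := @surj _ _ _ _ a y Dy.
  apply: (nEx i.+1 I); exists i => //=; rewrite aiy dC ltW//.
  exact: interior_subset xy.
have /choice[N NP] : forall k, exists n, (nu (~` E k n) <= (e / (2 ^ k.+1)%:R)%:E)%E.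
  move=> k; have e20 : 0 < e / (2 ^ k.+1)%:R by rewrite divr_gt0// ltr0n expn_gt0.
  have : nu (~` E k n) @[n --> \oo] --> nu (\bigcap_n ~` E k n).
    apply: nonincreasing_cvg_mu => //.
    - exact: (le_lt_trans (probability_le1 _ _) (ltry _)).
    - exact: bigcap_measurable.
    - move=> m n mn; apply/subsetPset; apply: subsetC => x [i /= im Bx].
      by exists i => //=; exact: leq_trans mn.
  rewrite capE measure0 => /fine_cvgP[nu_fin /cvgrPdist_lt/(_ _ e20) nu_small].
  have [n _ /(_ n (leqnn n))[fin_n lt_n]] := filterI nu_fin nu_small.
  exists n; rewrite -(fineK fin_n) lee_fin ltW//.
  by apply: le_lt_trans lt_n; rewrite sub0r normrN; exact: ler_norm.
exists (\bigcap_k E k (N k)); split.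
- exact: compact_totally_bounded.
- by apply: closed_bigI => k _; exact: cE.
- rewrite setC_bigcap; apply: (@le_trans _ _ (\sum_(k <oo) nu (~` E k (N k)))%E).
    by apply: measure_sigma_subadditive => //; exact: bigcup_measurable.
  apply: (le_trans _ (epsilon_trick0 xpredT (ltW e0))).
  by apply: lee_nneseries => k _ //; exact: NP.
Qed.

End metric.

(** * Products and countable sums *)

Section products.
Context {I : choiceType} {X_ : I -> ptopologicalType}.

(** Regularity says that the filter of closures of neighbourhoods converges,
    and convergence in a product is checked coordinatewise. *)
Lemma prod_topology_regular :
  (forall n, regular_space (X_ n)) -> regular_space (prod_topology X_).
Proof.
move=> regX a.
have FF : Filter (filter_from (nbhs a) closure).
  apply: filter_from_filter; first by exists setT; exact: filterT.
  move=> A B aA aB; exists (A `&` B); first exact: filterI.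
  by move=> x AB; split; move: x AB; apply: closureS => y [].
apply/cvg_sup => n U [V [[W oW <-] Wa WU]].
have [N Na NW] := regX n (a n) W (open_nbhs_nbhs (conj oW Wa)).
exists (proj n @^-1` N); first exact: (@proj_continuous _ X_ n a).
move=> x clx; apply: WU; apply: NW => B xB.
have [y [Ny By]] := clx (proj n @^-1` B) (@proj_continuous _ X_ n x _ xB).
by exists (proj n y).
Qed.

Lemma closed_prod (K : forall n, set (X_ n)) : (forall n, closed (K n)) ->
  closed [set f : prod_topology X_ | forall n, K n (f n)].
Proof.
move=> cK.
have -> : [set f : prod_topology X_ | forall n, K n (f n)] =
    \bigcap_n (proj n @^-1` K n).
  by apply/seteqP; split=> f Kf n; [move=> _; exact: Kf|exact: Kf].
apply: closed_bigI => n _.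
apply: ((@continuous_closedP (prod_topology X_) (X_ n) (proj n)).1 _ _ (cK n)).
exact: proj_continuous.
Qed.

Lemma measurable_coord n : measurable_fun [set: borel (prod_topology X_)]
  (fun x : borel (prod_topology X_) => x n : borel (X_ n)).
Proof.
apply: (@measurability _ _ (borel (prod_topology X_)) (borel (X_ n)) setT _ (@open (X_ n))) => //.
move=> _ [G oG <-]; rewrite setTI; apply: sub_sigma_algebra.
apply: ((@continuousP (prod_topology X_) (X_ n) (proj n)).1 _ _ oG).
exact: proj_continuous.
Qed.

End products.

Lemma esum_count {R : realType} {I : countType} (a : I -> \bar R) :
  (forall i, 0 <= a i)%E ->
  (\esum_(i in [set: I]) a i = \sum_(k <oo) oapp a 0 (@pickle_inv I k))%E.
Proof.
move=> a0; rewrite nneseries_esumT; last by move=> k; case: pickle_inv => /=.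
have -> : (\esum_(i in [set: I]) a i =
    \esum_(i in [set: I]) oapp a 0 (@pickle_inv I (pickle i)))%E.
  by apply: eq_esum => i _; rewrite pickleK_inv.
rewrite -(esum_image _ pickle (fun k => oapp a 0%E (@pickle_inv I k))); last first.
  by move=> i j _ _; exact: (pcan_inj (@pickleK_inv I)).
rewrite esum_mkcond; apply: eq_esum => k _; case: ifPn => // /negP nk.
case E : (@pickle_inv I k) => [i|//]; exfalso; apply: nk; apply/mem_set.
by exists i => //; have := @pickle_invK I k; rewrite E /=.
Qed.

Lemma esum_count_epsilon {R : realType} {I : countType} (e : R) : 0 < e ->
  exists a : I -> R, (forall i, 0 < a i) /\
    (\esum_(i in [set: I]) (a i)%:E <= e%:E)%E.
Proof.
move=> e0; exists (fun i => e / (2 ^ (pickle i).+1)%:R).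
have a0 k : 0 < e / (2 ^ k.+1)%:R by rewrite divr_gt0// ltr0n expn_gt0.
split=> //; rewrite esum_count => [|i]; last by rewrite lee_fin ltW.
apply: (le_trans _ (epsilon_trick0 xpredT (ltW e0))).
apply: lee_nneseries => k _; first by case: pickle_inv => //= i; rewrite lee_fin ltW.
case E : (@pickle_inv I k) => [i|] /=; last by rewrite lee_fin ltW.
by have := @pickle_invK I k; rewrite E /= => ->.
Qed.

Lemma esumZl {R : realType} {I : countType} (c : R) (a : I -> \bar R) :
  0 <= c -> (forall i, 0 <= a i)%E ->
  (\esum_(i in [set: I]) (c%:E * a i) = c%:E * \esum_(i in [set: I]) a i)%E.
Proof.
move=> c0 a0; rewrite !esum_count// => [|i]; last by rewrite mule_ge0.
rewrite -nneseriesZl => [|k _]; last by case: pickle_inv => /=.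
by apply: eq_eseriesr => k _; case: pickle_inv => //=; rewrite mule0.
Qed.

(** Were [g] everywhere larger than its mean [c], the positive function [g - c]
    would have integral zero. *)
Lemma exists_le_integral {R : realType} d (T : measurableType d)
    (P : probability T R) (g : T -> R) :
  measurable_fun setT g -> (forall x, 0 <= g x) ->
  (\int[P]_x (g x)%:E < +oo)%E ->
  exists x, ((g x)%:E <= \int[P]_x (g x)%:E)%E.
Proof.
move=> mg g0 goo; apply: contrapT => /forallNP gx.
have intg0 : (0 <= \int[P]_x (g x)%:E)%E.
  by apply: integral_ge0 => x _; rewrite lee_fin.
move: goo gx intg0; case E : (\int[P]_x (g x)%:E)%E => [c| |] // _ gx.
rewrite lee_fin => c0.
have gc x : c < g x.
  by rewrite ltNge; apply/negP => gxc; apply: (gx x); rewrite lee_fin.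
pose h (x : T) : R := g x - c.
have mgc : measurable_fun setT (EFin \o h).
  by apply/measurable_EFinP; apply: measurable_funB.
have gc0 x : setT x -> (0 <= (EFin \o h) x)%E.
  by move=> _; rewrite lee_fin subr_ge0 ltW.
have cP : (\int[P]_x cst c%:E x = c%:E)%E.
  by rewrite integral_cst//= probability_setT mule1.
have intgc : (\int[P]_x `|(EFin \o h) x| = 0)%E.
  have : (\int[P]_x (EFin \o h) x + c%:E = 0 + c%:E)%E.
    rewrite add0e -{1}cP -ge0_integralD//=.
    by rewrite -[RHS]E; apply: eq_integral => x _; rewrite -EFinD subrK.
  move/(congr1 (fun y => y - c%:E)%E); rewrite !addeK// => <-.
  by apply: eq_integral => x _; rewrite gee0_abs// gc0.
have /(ae_eq_integral_abs P measurableT mgc) [N [mN N0 subN]] := intgc.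
have : (P setT <= 0)%E.
  rewrite -N0; apply: le_measure; [exact: mem_set| exact: mem_set|].
  move=> x _; apply: subN => /= /(_ I) [] /eqP.
  by rewrite subr_eq0 gt_eqF.
by rewrite probability_setT lee_fin ler10.
Qed.

(** * Sublinearity of the dual value *)

Section duality.
Context {R : realType} {I : countType} {X_ : I -> ptopologicalType}.
Variable nu : forall n, probability (borel (X_ n)) R.
Let X := prod_topology X_.
Implicit Types (g : forall n, X_ n -> R) (f h : X -> R).

Local Notation G_family := (G_family nu).
Local Notation total_cost := (total_cost nu).

Lemma oplus_ge0 g x : G_family g -> (0 <= oplus g x)%E.
Proof. by move=> [gP _]; apply: esum_ge0 => n _; rewrite lee_fin; exact: (gP n).2. Qed.

Lemma oplusD g g' x : G_family g -> G_family g' ->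
  oplus (fun n y => g n y + g' n y) x = (oplus g x + oplus g' x)%E.
Proof.
move=> [gP _] [gP' _]; rewrite /oplus -esumD.
- by apply: eq_esum => n _; rewrite EFinD.
- by move=> n _; rewrite lee_fin; exact: (gP n).2.
- by move=> n _; rewrite lee_fin; exact: (gP' n).2.
Qed.

Lemma oplusZ c g x : 0 <= c -> G_family g ->
  oplus (fun n y => c * g n y) x = (c%:E * oplus g x)%E.
Proof.
move=> c0 [gP _]; rewrite /oplus -esumZl//.
by move=> n; rewrite lee_fin; exact: (gP n).2.
Qed.

Lemma marginal_cost_ge0 g n : borel_nneg (g n) -> (0 <= \int[nu n]_x (g n x)%:E)%E.
Proof. by move=> [_ g0]; apply: integral_ge0 => x _; rewrite lee_fin. Qed.

Lemma total_cost_fin g : G_family g -> total_cost g \is a fin_num.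
Proof.
move=> [gP goo]; rewrite ge0_fin_numE//.
by apply: esum_ge0 => n _; exact: marginal_cost_ge0.
Qed.

Lemma total_costD g g' : G_family g -> G_family g' ->
  total_cost (fun n y => g n y + g' n y) = (total_cost g + total_cost g')%E.
Proof.
move=> [gP _] [gP' _]; rewrite /Defs.total_cost -esumD => [|n _|n _].
- apply: eq_esum => n _; rewrite -ge0_integralD//=.
  + by move=> x _; rewrite lee_fin; exact: (gP n).2.
  + by apply/measurable_EFinP; exact: (gP n).1.
  + by move=> x _; rewrite lee_fin; exact: (gP' n).2.
  + by apply/measurable_EFinP; exact: (gP' n).1.
- exact: marginal_cost_ge0.
- exact: marginal_cost_ge0.
Qed.

Lemma total_costZ c g : 0 <= c -> G_family g ->
  total_cost (fun n y => c * g n y) = (c%:E * total_cost g)%E.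
Proof.
move=> c0 [gP _]; rewrite /Defs.total_cost -esumZl// => [|n]; last first.
  exact: marginal_cost_ge0.
apply: eq_esum => n _; rewrite -ge0_integralZl//=.
- by apply/measurable_EFinP; exact: (gP n).1.
- by move=> x _; rewrite lee_fin; exact: (gP n).2.
Qed.

Lemma G_familyD g g' : G_family g -> G_family g' ->
  G_family (fun n y => g n y + g' n y).
Proof.
move=> Gg Gg'; split; last first.
  by rewrite total_costD// lte_add_pinfty//; [exact: Gg.2|exact: Gg'.2].
move=> n; split; last by move=> x; rewrite addr_ge0//; [exact: (Gg.1 n).2|exact: (Gg'.1 n).2].
by apply: measurable_funD; [exact: (Gg.1 n).1|exact: (Gg'.1 n).1].
Qed.

Lemma G_familyZ c g : 0 <= c -> G_family g -> G_family (fun n y => c * g n y).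
Proof.
move=> c0 Gg; split; last first.
  rewrite total_costZ//; have /fineK <- := total_cost_fin Gg.
  by rewrite -EFinM ltry.
move=> n; split; last by move=> x; rewrite mulr_ge0//; exact: (Gg.1 n).2.
by apply: measurable_funM => //; exact: (Gg.1 n).1.
Qed.

Lemma total_cost0 : total_cost (fun _ _ => 0) = 0%E.
Proof. by apply: esum1 => n _; rewrite integral0. Qed.

Lemma G_family0 : G_family (fun _ _ => 0).
Proof. by split; [move=> n; split|rewrite total_cost0]. Qed.

(** Evaluate at a point each coordinate of which makes [g n] at most its mean.
    This is what bounds the infimum that defines [phi] from below. *)
Lemma total_cost_lb m g : G_family g -> (forall x : X, 0 <= m%:E + oplus g x)%E ->
  (0 <= m%:E + total_cost g)%E.
Proof.
move=> Gg mg.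
have gn_oo n : (\int[nu n]_y (g n y)%:E < +oo)%E.
  apply: le_lt_trans Gg.2.
  rewrite -(@esum_set1 _ _ n (fun k => \int[nu k]_y (g k y)%:E)%E); last first.
    exact/marginal_cost_ge0/Gg.1.
  rewrite esum_mkcond; apply: le_esum => k _; case: ifPn => // _.
  exact/marginal_cost_ge0/Gg.1.
have gx n : exists x : X_ n, ((g n x)%:E <= \int[nu n]_y (g n y)%:E)%E.
  by apply: (exists_le_integral (Gg.1 n).1 (Gg.1 n).2).
pose x : X := fun n => projT1 (cid (gx n)).
apply: (le_trans (mg x)); rewrite leeD2l//; apply: le_esum => n _.
exact: (projT2 (cid (gx n))).
Qed.

(** The constant [m] makes bounded functions members even when there are no
    coordinates, in which case [oplus g] vanishes.  Nonmeasurable functions are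
    admitted, so that a functional on this space can be evaluated at the
    indicator of any set. *)
Definition dominated : set (X -> R^o) :=
  [set f | exists m g, G_family g /\ forall x, (`|f x|%:E <= m%:E + oplus g x)%E].

Lemma dominatedD f h : dominated f -> dominated h -> dominated (f + h).
Proof.
move=> [m [g [Gg fg]]] [m' [g' [Gg' hg]]].
exists (m + m'), (fun n y => g n y + g' n y); split; first exact: G_familyD.
move=> x; rewrite oplusD// EFinD addeACA.
by apply: le_trans (leeD (fg x) (hg x)); rewrite -EFinD lee_fin ler_normD.
Qed.

Lemma dominatedZ c f : dominated f -> dominated (c *: (f : X -> R^o)).
Proof.
move=> [m [g [Gg fg]]]; exists (`|c| * m), (fun n y => `|c| * g n y).
split; first exact: G_familyZ.
move=> x; rewrite oplusZ// EFinM -muleDr ?fin_num_adde_defr//.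
by rewrite normrM EFinM lee_wpmul2l// ?lee_fin.
Qed.

Lemma phi_le f m g : G_family g -> (forall x, ((f x)%:E <= m%:E + oplus g x)%E) ->
  (phi nu f <= m%:E + total_cost g)%E.
Proof. by move=> Gg fg; apply: ereal_inf_lbound; exists m, g. Qed.

Lemma dominated_phi_fin f : dominated f -> phi nu f \is a fin_num.
Proof.
move=> [m [g [Gg fg]]].
have fin_mg : (m%:E + total_cost g)%E \is a fin_num by rewrite fin_numD/= total_cost_fin.
have lb : (- (m%:E + total_cost g) <= phi nu f)%E.
  apply: le_ereal_inf_tmp => _ [m' [g' [Gg' fg' ->]]].
  rewrite leeNl -sube_ge0 ?oppeK; last by rewrite fin_mg orbT.
  rewrite addeACA -EFinD -total_costD//.
  apply: total_cost_lb; first exact: G_familyD.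
  move=> x; rewrite oplusD// EFinD addeACA.
  apply: le_trans (leeD (fg x) (fg' x)).
  by rewrite -EFinD lee_fin -lerBlDr sub0r ler_normr lexx orbT.
apply/fin_numPlt/andP; split.
  by apply: lt_le_trans lb; rewrite ltNye_eq fin_numN fin_mg.
apply: (@le_lt_trans _ _ (m%:E + total_cost g)%E); last by rewrite ltey_eq fin_mg.
apply: phi_le => // x; apply: le_trans (fg x).
by rewrite lee_fin ler_norm.
Qed.

Lemma fine_phi_le f m g : dominated f -> G_family g ->
  (forall x, ((f x)%:E <= m%:E + oplus g x)%E) ->
  fine (phi nu f) <= m + fine (total_cost g).
Proof.
move=> /dominated_phi_fin/fineK Wf Gg fg; rewrite -lee_fin EFinD Wf.
by rewrite fineK ?total_cost_fin//; exact: phi_le.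
Qed.

Lemma le_fine_phi f b : dominated f ->
  (forall m g, G_family g -> (forall x, ((f x)%:E <= m%:E + oplus g x)%E) ->
    b <= m + fine (total_cost g)) ->
  b <= fine (phi nu f).
Proof.
move=> /dominated_phi_fin/fineK Wf bf; rewrite -lee_fin Wf.
apply: le_ereal_inf_tmp => _ [m [g [Gg fg ->]]].
by rewrite -[total_cost g]fineK ?total_cost_fin// -EFinD lee_fin; exact: bf.
Qed.

Lemma sublinear_phi :
  sublinear_on dominated (fun f : X -> R^o => fine (phi nu f)).
Proof.
split=> [f h Wf Wh|c f c0 Wf].
  rewrite -lerBlDr; apply: le_fine_phi => // m g Gg fg.
  rewrite lerBlDr [leRHS]addrC -lerBlDr; apply: le_fine_phi => // m' g' Gg' hg.
  rewrite lerBlDr addrACA -fineD ?total_cost_fin// -total_costD//.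
  apply: fine_phi_le; [exact: dominatedD|exact: G_familyD|].
  move=> x; rewrite oplusD// [(m' + m)%:E]EFinD addeACA addrC EFinD.
  exact: leeD.
rewrite mulrC -ler_pdivrMr//; apply: le_fine_phi => // m g Gg fg.
rewrite ler_pdivrMr// mulrC mulrDr.
have -> : c * fine (total_cost g) = fine (total_cost (fun n y => c * g n y)).
  by rewrite total_costZ ?ltW// fineM// total_cost_fin.
apply: fine_phi_le; [exact: dominatedZ|exact/G_familyZ/Gg/ltW|].
move=> x; have -> : ((c *: f) x)%:E = (c%:E * (f x)%:E)%E by [].
rewrite (oplusZ _ (ltW c0) Gg) EFinM -muleDr ?fin_num_adde_defr//.
by rewrite lee_pmul2l// ?lte_fin.
Qed.

End duality.

(** * Integration against couplings and weak duality *)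

Section couplings.
Context {R : realType} {I : countType} {X_ : I -> ptopologicalType}.
Variable nu : forall n, probability (borel (X_ n)) R.
Let X := prod_topology X_.
Variable mu : probability (borel X) R.
Hypothesis mu_coupling : couplings nu mu.

(* the terms of [oplus], listed along the enumeration of the index type *)
Let coordE (g : forall n, X_ n -> R) (x : X) k : \bar R :=
  oapp (fun n => (g n (x n))%:E) 0%E (@pickle_inv I k).

Let oplusE g x : G_family nu g -> oplus g x = (\sum_(k <oo) coordE g x k)%E.
Proof.
move=> [gP _]; rewrite /oplus esum_count// => n.
by rewrite lee_fin; exact: (gP n).2.
Qed.

Let coordE_ge0 g x k : G_family nu g -> (0 <= coordE g x k)%E.
Proof.
move=> [gP _]; rewrite /coordE; case: pickle_inv => //= n.
by rewrite lee_fin; exact: (gP n).2.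
Qed.

Let measurable_coordE g k : G_family nu g ->
  measurable_fun [set: borel X] (fun x : borel X => coordE g x k).
Proof.
move=> [gP _]; rewrite /coordE; case: pickle_inv => [n|] /=; last exact: measurable_cst.
apply/measurable_EFinP; apply: (measurableT_comp (gP n).1).
exact: measurable_coord.
Qed.

Lemma measurable_oplus g : G_family nu g ->
  measurable_fun [set: borel X] (oplus g : borel X -> \bar R).
Proof.
move=> Gg; rewrite (_ : oplus g = fun x => (\sum_(k <oo) coordE g x k)%E); last first.
  by apply/funext => x; exact: oplusE.
apply: ge0_emeasurable_sum => [k x _ _|k _]; first exact: coordE_ge0.
exact: measurable_coordE.
Qed.

Lemma integral_oplus g : G_family nu g ->
  (\int[mu]_x oplus g x = total_cost nu g)%E.
Proof.
move=> Gg.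
under eq_integral => x _ do rewrite oplusE//.
rewrite integral_nneseries//=; last 2 first.
- by move=> k; exact: measurable_coordE.
- by move=> k x _; exact: coordE_ge0.
rewrite /total_cost esum_count => [|n]; last exact/marginal_cost_ge0/Gg.1.
apply: eq_eseriesr => k _; rewrite /coordE.
case: pickle_inv => [n|] /=; last by rewrite integral0.
have [mg g0] := Gg.1 n.
have mgE : measurable_fun setT (EFin \o g n : borel (X_ n) -> \bar R).
  exact/measurable_EFinP.
have gE0 : {in setT, forall y, (0 <= (EFin \o g n) y)%E}.
  by move=> y _; rewrite lee_fin.
have := ge0_integral_pushforward (@measurable_coord _ X_ n) mu measurableT mgE gE0.
rewrite preimage_setT => <-; apply: eq_measure_integral; first exact: measurable_coord.
by move=> mcoord A mA _; exact: mu_coupling.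
Qed.

Lemma integrable_oplus m g : G_family nu g ->
  mu.-integrable setT (fun x : borel X => m%:E + oplus g x)%E.
Proof.
move=> Gg; apply: integrableD => //; first exact: finite_measure_integrable_cst.
apply/integrableP; split; first exact: measurable_oplus.
under eq_integral => x _ do rewrite gee0_abs ?(oplus_ge0 _ Gg)//.
by rewrite integral_oplus//; exact: Gg.2.
Qed.

Lemma integral_cst_oplus m g : G_family nu g ->
  (\int[mu]_x (m%:E + oplus g x) = m%:E + total_cost nu g)%E.
Proof.
move=> Gg; rewrite integralD//=.
- by rewrite integral_cst//= probability_setT mule1 integral_oplus.
- exact: finite_measure_integrable_cst.
- have := integrable_oplus 0 Gg; apply: eq_integrable => // x _.
  by rewrite add0e.
Qed.

Lemma dominated_integrable (f : X -> R) : borel_fun f -> dominated nu f ->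
  mu.-integrable setT (EFin \o f : borel X -> \bar R).
Proof.
move=> mf [m [g [Gg fg]]].
apply: (le_integrable measurableT _ _ (integrable_oplus m Gg)).
  exact/measurable_EFinP.
move=> x _ /=; apply: le_trans (lee_abs _); exact: fg.
Qed.

Lemma integral_le_phi (f : X -> R) : borel_fun f -> dominated nu f ->
  (\int[mu]_x (f x)%:E <= phi nu f)%E.
Proof.
move=> mf Wf; apply: le_ereal_inf_tmp => _ [m [g [Gg fg ->]]].
rewrite -integral_cst_oplus//; apply: le_integral => //.
- exact: dominated_integrable.
- exact: integrable_oplus.
Qed.

End couplings.

(** * The coupling attached to a dominated functional *)

(** The sum counts the integers in [1 .. J] that are less than [t]. *)
Lemma staircase_bounds (R : realType) (t : R) J : 0 <= t ->
  \sum_(j < J) (j.+1%:R < t)%R%:R <= t /\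
  (t <= J%:R -> t - 1 <= \sum_(j < J) (j.+1%:R < t)%R%:R).
Proof.
move=> t0; set S := fun J => \sum_(j < J) ((j.+1%:R < t)%R%:R : R).
have full K : K%:R < t -> S K = K%:R.
  elim: K => [_|K ih Kt]; first by rewrite /S big_ord0.
  rewrite /S big_ord_recr/= -/(S K) ih ?Kt ?natr1//.
  by apply: lt_trans Kt; rewrite ltr_nat.
rewrite -/(S J); split; elim: J => [|J ih].
- by rewrite /S big_ord0.
- rewrite /S big_ord_recr/= -/(S J); case: ltP => Jt; last by rewrite addr0.
  rewrite full; last by apply: lt_trans Jt; rewrite ltr_nat.
  by rewrite natr1 ltW.
- by move=> t0'; rewrite /S big_ord0; lra.
- move=> tJ1; rewrite /S big_ord_recr/= -/(S J) ltNge tJ1 addr0.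
  have [tJ|Jt] := leP t J%:R; first exact: ih.
  by rewrite full//; move: tJ1; rewrite -natr1; lra.
Qed.

Section functional.
Context {R : realType} {I : countType} {X_ : I -> ptopologicalType}.
Variable nu : forall n, probability (borel (X_ n)) R.
Let X := prod_topology X_.
Variable l : (X -> R^o) -> R.
Hypothesis l_le : forall f, dominated nu f -> l f <= fine (phi nu f).
Hypothesis lD : forall f h, dominated nu f -> dominated nu h -> l (f + h) = l f + l h.

Lemma dominated_bounded m (f : X -> R^o) : (forall x, `|f x| <= m) -> dominated nu f.
Proof.
move=> fm; exists m, (fun _ _ => 0); split; first exact: G_family0.
by move=> x; rewrite /oplus esum1// adde0 lee_fin.
Qed.

Lemma functional_le (f : X -> R^o) m g : dominated nu f -> G_family nu g ->
  (forall x, ((f x)%:E <= m%:E + oplus g x)%E) -> l f <= m + fine (total_cost nu g).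
Proof. by move=> Wf Gg fg; apply: (le_trans (l_le Wf)); exact: fine_phi_le. Qed.

Lemma functional_le_cst (f : X -> R^o) m : dominated nu f -> (forall x, f x <= m) -> l f <= m.
Proof.
move=> Wf fm; rewrite -[m]addr0 -[0](_ : fine (total_cost nu (fun _ _ => 0)) = _).
  apply: functional_le => //; first exact: G_family0.
  by move=> x; rewrite /oplus esum1// adde0 lee_fin.
by rewrite total_cost0.
Qed.

Lemma functional0 : l 0 = 0.
Proof.
have W0 : dominated nu 0 by apply: (@dominated_bounded 0) => x; rewrite normr0.
by have := lD W0 W0; rewrite addr0; lra.
Qed.

Lemma dominatedN (f : X -> R^o) : dominated nu f -> dominated nu (- f).
Proof. by move=> Wf; rewrite -scaleN1r; exact: dominatedZ. Qed.

Lemma functionalN (f : X -> R^o) : dominated nu f -> l (- f) = - l f.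
Proof.
move=> Wf; have := lD Wf (dominatedN Wf).
by rewrite subrr functional0; lra.
Qed.

Lemma functional_mono (f h : X -> R^o) : dominated nu f -> dominated nu h ->
  (forall x, f x <= h x) -> l f <= l h.
Proof.
move=> Wf Wh fh; have WNh := dominatedN Wh.
have : l (f - h) <= 0.
  by apply: functional_le_cst => [|x]; [exact: dominatedD|rewrite [_ x]/(f x - h x) subr_le0].
by rewrite lD// functionalN//; lra.
Qed.

Lemma functional_cst m : l (fun=> m) = m.
Proof.
have Wm c : dominated nu (fun=> c : R^o) by exact: (@dominated_bounded `|c|).
apply/eqP; rewrite eq_le functional_le_cst//= -[m in m <= _]opprK lerNl -functionalN//.
by apply: functional_le_cst => //; exact: Wm.
Qed.

Lemma dominated_sum (F : nat -> X -> R^o) n : (forall i, dominated nu (F i)) ->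
  dominated nu (\sum_(i < n) F i).
Proof.
move=> WF; elim: n => [|n ih]; last by rewrite big_ord_recr; exact: dominatedD.
by rewrite big_ord0; apply: (@dominated_bounded 0) => x; rewrite normr0.
Qed.

Lemma functional_sum (F : nat -> X -> R^o) n : (forall i, dominated nu (F i)) ->
  l (\sum_(i < n) F i) = \sum_(i < n) l (F i).
Proof.
move=> WF; elim: n => [|n ih]; first by rewrite !big_ord0 functional0.
by rewrite !big_ord_recr/= lD ?ih//; exact: dominated_sum.
Qed.

Definition functional_set (A : set X) : R := l (\1_A : X -> R^o).

Lemma dominated_indic (A : set X) : dominated nu (\1_A : X -> R^o).
Proof.
apply: (@dominated_bounded 1) => x.
by rewrite ger0_norm indicE//; case: (_ \in _).
Qed.

Lemma functional_set_ge0 A : 0 <= functional_set A.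
Proof.
rewrite -functional0; apply: functional_mono; last by move=> x; rewrite indicE.
  by apply: (@dominated_bounded 0) => x; rewrite normr0.
exact: dominated_indic.
Qed.

Lemma functional_setU A B : A `&` B = set0 ->
  functional_set (A `|` B) = functional_set A + functional_set B.
Proof.
move=> AB0; rewrite /functional_set -lD; [|exact: dominated_indic..].
congr l; apply/funext => x; transitivity (\1_A x + \1_B x : R); last by [].
rewrite !indicE in_setU.
have [xA|xA] := boolP (x \in A); have [xB|xB] := boolP (x \in B); rewrite ?addr0 ?add0r//.
have : (A `&` B) x by split; exact: set_mem.
by rewrite AB0.
Qed.

Lemma functional_setT : functional_set setT = 1.
Proof. by rewrite /functional_set indicT functional_cst. Qed.

(** The indicator of the union is at most [oplus] of the indicators of the
    bases, so [l <= phi] gives the bound even for infinitely many cylinders,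
    although [l] is only finitely additive. *)
Lemma functional_set_cylinders (A : forall n, set (X_ n)) :
  (forall n, measurable (A n : set (borel (X_ n)))) ->
  ((functional_set (\bigcup_n (proj n @^-1` A n)))%:E <=
   \esum_(n in [set: I]) nu n (A n))%E.
Proof.
move=> mA.
have costE : total_cost nu (fun n => \1_(A n)) = (\esum_(n in [set: I]) nu n (A n))%E.
  by apply: eq_esum => n _; rewrite integral_indic// setIT.
have [Aoo|] := ltP (\esum_(n in [set: I]) nu n (A n))%E +oo%E; last first.
  by rewrite leye_eq => /eqP ->; rewrite leey.
have GA : G_family nu (fun n => \1_(A n)).
  split; last by rewrite costE.
  by move=> n; split => [|x]; [exact: measurable_indic|rewrite indicE].
rewrite -costE -(fineK (total_cost_fin GA)) lee_fin -[leRHS]add0r.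
apply: functional_le => //; first exact: dominated_indic.
move=> x; rewrite add0e indicE; case: (boolP (x \in _)) => [|_]; last exact: (oplus_ge0 x GA).
move=> /set_mem[n _ /= Anx]; rewrite /oplus; apply: esum_ge.
exists [set n]; first by split; [exact: finite_set1|].
by rewrite fsbig_set1 indicE mem_set.
Qed.

Hypothesis polishX : forall n, polish R (X_ n).

Lemma functional_set_tight e : 0 < e ->
  exists K, [/\ compact K, closed K & functional_set (~` K) <= e].
Proof.
move=> e0; have [a [a0 ae]] := @esum_count_epsilon R I e e0.
have exK n : exists K, [/\ compact K, closed K & (nu n (~` K) <= (a n)%:E)%E].
  have [[d dP] [D cD dD]] := polishX n.
  exact: complete_separable_tight dP _ _ _ cD dD (a0 n).
pose K n := projT1 (cid (exK n)).
have KP n : [/\ compact (K n), closed (K n) & (nu n (~` K n) <= (a n)%:E)%E].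
  exact: (projT2 (cid (exK n))).
exists [set f | forall n, K n (f n)]; split.
- by apply: tychonoff => n; have [] := KP n.
- by apply: closed_prod => n; have [] := KP n.
have -> : ~` [set f | forall n, K n (f n)] = \bigcup_n (proj n @^-1` (~` K n)) :> set X.
  apply/seteqP; split=> [f /existsNP[n nK]|f [n _ nK]]; first by exists n.
  by move=> /(_ n).
rewrite -lee_fin; apply: (le_trans (functional_set_cylinders _)) => [n|].
  by apply: sub_sigma_algebra; apply: closed_openC; have [] := KP n.
by apply: le_trans ae; apply: le_esum => n _; have [] := KP n.
Qed.

(** For an open [G] in one factor, the bound on cylinders applied with empty
    bases in the other factors shows that the marginal is at most [nu n] on
    open sets, hence equal to it. *)
Lemma exists_coupling_le_open : exists mu : probability (borel X) R,
  couplings nu mu /\ forall G : set X, open G -> (mu G <= (functional_set G)%:E)%E.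
Proof.
have regX : regular_space X.
  apply: prod_topology_regular => n; have [[d dP] _] := polishX n.
  exact: (metrizable_regular dP).
(* the join of the topological and the pointed structure of the product *)
pose PX : ptopologicalType := HB.pack X (Topological.on X) (Pointed.on (forall n, X_ n)).
have [mu muG] := @exists_probability_le_open R PX
  functional_set regX functional_set_ge0 functional_setU
  functional_setT functional_set_tight.
exists mu; split => // n A mA.
have [[d dP] _] := polishX n.
apply: (measure_eq_of_le_open dP
  (mu := pushforward mu (fun x : borel X => x n : borel (X_ n)))) => //.
- exact: measurable_coord.
- by move=> mcoord; exact: (@probability_setT _ _ _ mu).
- move=> mcoord G oG.
  have oprojG : open (proj n @^-1` G : set X).
    apply: ((@continuousP (prod_topology X_) (X_ n) (proj n)).1 _ _ oG).
    exact: proj_continuous.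
  apply: (le_trans (muG _ oprojG)).
  pose A' := dfwith (fun k => set0 : set (X_ k)) n G.
  have -> : proj n @^-1` G = \bigcup_k (proj k @^-1` A' k) :> set X.
    apply/seteqP; split=> [x Gx|x [k _]].
      by exists n => //; rewrite /A' /= dfwithin.
    by rewrite /A' /=; case: dfwithP => [//|k' _ []].
  apply: (le_trans (functional_set_cylinders _)) => [k|].
    by rewrite /A'; case: dfwithP => [|k' _]; [exact: sub_sigma_algebra|exact: measurable0].
  have -> : nu n G = \esum_(k in [set n]) nu k (A' k).
    by rewrite esum_set1// /A' dfwithin.
  rewrite [leRHS]esum_mkcond; apply: le_esum => k _.
  case: ifPn => // /negP nk; rewrite /A'; move: nk; case: dfwithP => [|k' _ _].
    by case; exact/mem_set.
  by rewrite measure0.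
Qed.

(** Counting superlevel sets, [1 / (n + 1)] times the number of
    [1 <= j <= (n + 1) ^ 2] with [j / (n + 1) < v x] is at most [v x], and within
    [1 / (n + 1)] of it as soon as [v x <= n + 1].  The integral of this
    approximation is bounded by comparing [mu] and [l] on each open superlevel
    set and using that [l] is additive and monotone; dominated convergence
    gives the limit. *)
Lemma integral_lsc_le (mu : probability (borel X) R) (v : X -> R) :
  couplings nu mu -> (forall G : set X, open G -> (mu G <= (functional_set G)%:E)%E) ->
  borel_fun v -> dominated nu v -> (forall x, 0 <= v x) ->
  (forall t, open [set x : X | t < v x]) ->
  (\int[mu]_x (v x)%:E <= (l v)%:E)%E.
Proof.
move=> mu_coupling muG mv Wv v0 v_lsc.
pose G n j := [set x : X | j.+1%:R < n.+1%:R * v x].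
have oG n j : open (G n j).
  have -> : G n j = [set x | j.+1%:R / n.+1%:R < v x].
    by apply/seteqP; split=> x; rewrite /G/= ltr_pdivrMr// mulrC.
  exact: v_lsc.
have mG n j : measurable (G n j : set (borel X)) by exact: sub_sigma_algebra.
pose stair n (x : X) : R := n.+1%:R^-1 * \sum_(j < n.+1 * n.+1) \1_(G n j) x.
have stairE n x :
    n.+1%:R * stair n x = \sum_(j < n.+1 * n.+1) (j.+1%:R < n.+1%:R * v x)%R%:R.
  rewrite /stair mulrA divff ?mul1r//; apply: eq_bigr => j _.
  by rewrite indicE; congr (nat_of_bool _)%:R; apply/idP/idP => [/set_mem|/mem_set].
have nv0 n x : 0 <= n.+1%:R * v x by rewrite mulr_ge0.
have stair_le n x : stair n x <= v x.
  rewrite -(ler_pM2l (ltr0Sn R n)) stairE.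
  by have [] := staircase_bounds (n.+1 * n.+1) (nv0 n x).
have stair_ge0 n x : 0 <= stair n x.
  by rewrite mulr_ge0// sumr_ge0// => j _; rewrite indicE.
have le_stair n x : v x <= n.+1%:R -> v x - n.+1%:R^-1 <= stair n x.
  move=> vn; rewrite -(ler_pM2l (ltr0Sn R n)) stairE mulrBr divff//.
  have [_] := staircase_bounds (n.+1 * n.+1) (nv0 n x); apply.
  by rewrite natrM ler_pM2l.
have mstair n : measurable_fun setT (stair n : borel X -> R).
  apply: measurable_funM => //; apply: measurable_sum => j.
  exact: measurable_indic.
have stair_cvg (x : X) : (stair n x)%:E @[n --> \oo] --> (v x)%:E.
  apply: cvg_EFin; first exact: nearW.
  apply/cvgrPdist_le => e e0 /=.
  near=> n.
  have le_n : v x <= n.+1%:R.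
    near: n; exists (Num.bound (v x)) => // n /= bn.
    apply: (le_trans (ltW (archi_boundP (v0 x)))).
    by rewrite ler_nat; exact: leqW.
  have vs := le_stair n x le_n; have sv := stair_le n x.
  have ne : n.+1%:R^-1 < e by near: n; exact: (near_infty_natSinv_lt (PosNum e0)).
  move: (n.+1%:R^-1) ne vs => r ne vs; rewrite ger0_norm; lra.
have int_stair n : (\int[mu]_x (stair n x)%:E <= (l v)%:E)%E.
  have -> : (\int[mu]_x (stair n x)%:E =
      (n.+1%:R^-1)%:E * \sum_(j < n.+1 * n.+1) mu (G n j))%E.
    transitivity (\int[mu]_x ((n.+1%:R^-1)%:E *
        \sum_(j < n.+1 * n.+1) (\1_(G n j) x)%:E))%E.
      by apply: eq_integral => x _; rewrite sumEFin -EFinM.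
    rewrite ge0_integralZl//=.
    - rewrite ge0_integral_sum//=.
      + by congr (_ * _)%E; apply: eq_bigr => j _; rewrite integral_indic// setIT.
      + by move=> j; apply/measurable_EFinP; exact: measurable_indic.
    - apply: emeasurable_sum => j; apply/measurable_EFinP; exact: measurable_indic.
    - by move=> x _; apply: sume_ge0 => j _; rewrite /= lee_fin indicE.
  apply: (@le_trans _ _ ((n.+1%:R^-1)%:E *
      \sum_(j < n.+1 * n.+1) (functional_set (G n j))%:E)%E).
    by apply: lee_wpmul2l => //; apply: lee_sum => j _; exact: muG.
  rewrite sumEFin -EFinM lee_fin ler_pdivrMl//.
  have nvE k : l (fun x => k%:R * v x) = k%:R * l v.
    have -> : (fun x => k%:R * v x) = \sum_(j < k) (v : X -> R^o).
      by apply/funext => x; rewrite fct_sumE sumr_const card_ord mulr_natl.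
    by rewrite (functional_sum (F := fun=> v : X -> R^o))// sumr_const card_ord mulr_natl.
  rewrite -nvE -(functional_sum (F := fun j => \1_(G n j) : X -> R^o)); last first.
    by move=> j; exact: dominated_indic.
  apply: functional_mono.
  - apply: (dominated_sum (F := fun j => \1_(G n j) : X -> R^o)) => j.
    exact: dominated_indic.
  - exact: (dominatedZ _ Wv).
  - move=> x; have := stair_le n x.
    by rewrite -(ler_pM2l (ltr0Sn R n)) /stair mulrA divff ?mul1r// fct_sumE.
have int_cvg : (\int[mu]_x (EFin \o stair n) x @[n --> \oo] --> \int[mu]_x (v x)%:E)%E.
  apply: (@dominated_cvg _ _ _ mu setT measurableT (fun n => EFin \o stair n) _
    (EFin \o v : borel X -> \bar R)) => //.
  - by move=> n; apply/measurable_EFinP.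
  - by move=> x _; exact: stair_cvg.
  - exact: (dominated_integrable mu_coupling mv Wv).
  - by move=> n x _; rewrite /= lee_fin ger0_norm.
by apply: (cvge_to_le int_cvg); apply: nearW => n; exact: int_stair.
Unshelve. all: by end_near. Qed.

End functional.

Lemma B_space_dominated (R : realType) (I : countType) (X_ : I -> ptopologicalType)
    (nu : forall n, probability (borel (X_ n)) R) (f : prod_topology X_ -> R) :
  B_space nu f -> dominated nu f.
Proof.
move=> [_ [_ [g Gg <-] fg]]; exists 0, g; split => // x.
by rewrite add0e; exact: fg.
Qed.

Lemma U_space_dominated (R : realType) (I : countType) (X_ : I -> ptopologicalType)
    (nu : forall n, probability (borel (X_ n)) R) (h : prod_topology X_ -> R) :
  U_space nu h -> dominated nu h.
Proof.
move=> [_ _ [_ [M hM]] [_ [_ [g Gg <-] hg]]].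
exists M, g; split => // x; apply: le_trans (leeD (_ : (`|h^\+ x|%:E <= M%:E)%E) (hg x)).
  rewrite -EFinD lee_fin; apply: le_trans (ler_normB _ _).
  by rewrite -{1}[h](funrposBneg h).
by rewrite lee_fin.
Qed.

Theorem corollary4p2 (R : realType) (I : countType)
    (X_ : I -> ptopologicalType) (polishX : forall n : I, polish R (X_ n))
    (nu : forall n : I, probability (borel (X_ n)) R)
    (f : prod_topology X_ -> R)
    (fB : B_space nu f) (fUG : UG_space nu (EFin \o f)) :
  let values := [set (\int[mu]_x (f x)%:E)%E | mu in couplings nu] in
  values (phi nu f) /\ ubound values (phi nu f).
Proof.
have Wf := B_space_dominated fB; have [mf _] := fB.
split; last by move=> _ [mu mu_coupling <-]; exact: integral_le_phi.
have [h Uh [_ [g Gg <-] fE]] := fUG.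
have Wh := U_space_dominated Uh; have [mh usc_h [_ [M hM]] _] := Uh.
have [l [l_le lD lf]] := hahn_banach_on (@dominatedD _ _ _ nu) (@dominatedZ _ _ _ nu)
  (sublinear_phi nu) Wf.
have [mu [mu_coupling mu_le]] := exists_coupling_le_open l_le lD polishX.
exists mu => //; apply/eqP; rewrite eq_le integral_le_phi//=.
have gE x : oplus g x = (f x - h x)%:E.
  have := congr1 (fun F => F x - (h x)%:E)%E fE.
  by rewrite /= addeAC subee// add0e.
have Wk : dominated nu (f - h) by apply: dominatedD => //; exact: dominatedN.
have lk : l (f - h) <= fine (total_cost nu g).
  by rewrite -[leRHS]add0r; apply: (functional_le l_le) => // x; rewrite add0e gE.
have h_le x : h x <= M.
  by apply: (le_trans _ (le_trans (ler_norm _) (hM x))); rewrite /funrpos le_max lexx.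
(* lower semicontinuous and nonnegative: the inequality on open sets applies *)
pose v x : R := M - h x.
have WM : dominated nu (fun=> M) by exact: (@dominated_bounded _ _ _ nu `|M|).
have Wv : dominated nu v by apply: dominatedD WM _; exact: dominatedN.
have mv : borel_fun v by apply: measurable_funB.
have lv : l v = M - l h.
  rewrite (lD (fun=> M) (- h))//; last exact: dominatedN.
  by rewrite (functional_cst l_le lD) (functionalN lD).
have vint : (\int[mu]_x (v x)%:E <= (l v)%:E)%E.
  apply: (integral_lsc_le l_le lD) => //.
  - by move=> x; rewrite subr_ge0.
  - move=> t; rewrite openE => x /= tv.
    have : h x < M - t by rewrite /v in tv; lra.
    move=> /usc_h; apply: filterS => y; rewrite /v /=; lra.
have -> : (\int[mu]_x (f x)%:E = (M%:E + total_cost nu g) - \int[mu]_x (v x)%:E)%E.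
  rewrite -(integral_cst_oplus mu_coupling)// -integralB//=.
  - by apply: eq_integral => x _; rewrite gE -!EFinD /v; congr EFin; lra.
  - exact: (integrable_oplus mu_coupling).
  - exact: (dominated_integrable mu_coupling).
have := dominated_phi_fin Wf; have := total_cost_fin Gg.
move=> /fineK <- /fineK <-; rewrite -lf.
have -> : l f = l h + l (f - h).
  by rewrite -lD//; congr l; rewrite addrC subrK.
apply: (@le_trans _ _ ((M + fine (total_cost nu g))%:E - (l v)%:E)%E).
  by rewrite -EFinB lee_fin lv; lra.
by rewrite EFinD leeB.
Qed.
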